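(* Let $m\geq3$ be an integer. Then $$\int_0^\infty\left(\sqrt{1+t^m}-t^{\frac m2}\right)dt=\frac{\sqrt\pi}{2\cos\left(\frac\pi m\right)}\,\frac{\Gamma\left(1+\frac1m\right)}{\Gamma\left(\frac32+\frac1m\right)}.$$ *)

(* Defs.v *)
From Stdlib Require Import Reals.
From Coquelicot Require Import Coquelicot.
Open Scope R_scope.

Definition Gamma (x : R) : R :=
  RInt_gen (fun t => Rpower t (x - 1) * exp (- t)) (at_right 0) (Rbar_locally p_infty).

(* Main.v *)
Require Import Defs.
From Stdlib Require Import Reals Lra Lia.
From Coquelicot Require Import Coquelicot.
Open Scope R_scope.

(** Put [a = 1 / m]. Two integrations by parts and the substitution [u = t ^ m] turn the integral
    into [M (1 + a, 3 / 2) / (4 (1 / 2 + a))], where [M (s, b)] is the beta integral of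
    [u ^ (s - 1) (1 + u) ^ (- b)] from [0] to infinity, equal to [B (s, b - s)]. It is evaluated without
    double integrals. One has [b M (s, b + 1) = (b - s) M (s, b)], and [u = exp w - 1] together with
    [w <= exp w - 1 <= w exp w] gives
    [Gamma s / (b - 1) ^ s <= M (s, b) <= Gamma s / (b - s) ^ s] for [s >= 1].
    Let [C_k] be the integral of [cos (2 a t) cos t ^ k] from [0] to [PI / 2], which satisfies
    [(k ^ 2 - 4 a ^ 2) C_k = k (k - 1) C_(k - 2)]. The recurrences make
    [P_n C_(2 n + 1) (n + 1 / 2 - a) / (Q_n (n + 3 / 2 + a))] independent of [n], where
    [P_n = M (1 + a, 3 / 2 + n)] and [Q_n = M (3 / 2 + a, 5 / 2 + a + n)]. At [n = 0] it is the
    wanted integral times [cos (PI a)]; as [n] grows, the bounds on [M] and Wallis' asymptotics of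
    [C_k] give the limit [sqrt PI / 2 * Gamma (1 + a) / Gamma (3 / 2 + a)]. *)

(** * Improper integrals over the positive half-line *)

Notation is_RInt_pos f l := (is_RInt_gen f (at_right 0) (Rbar_locally p_infty) l)
  (only parsing).

Lemma ex_RInt_of_continuous_pos (f : R -> R) (a b : R) :
  (forall x, 0 < x -> continuous f x) -> 0 < a -> 0 < b -> ex_RInt f a b.
Proof.
  intros hf ha hb. apply (ex_RInt_continuous (V := R_CompleteNormedModule)).
  intros z [hz _]. apply hf.
  apply Rlt_le_trans with (2 := hz). now apply Rmin_glb_lt.
Qed.

Lemma filter_prod_pos (P : R -> R -> Prop) (d : posreal) (B : R) :
  (forall a b, 0 < a < d -> B < b -> P a b) ->
  filter_prod (at_right 0) (Rbar_locally p_infty) (fun ab => P (fst ab) (snd ab)).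
Proof.
  intros hP.
  exists (fun a => 0 < a < d) (fun b => B < b).
  - exists d. intros y hy hy0. split; [exact hy0|].
    unfold ball in hy; simpl in hy; unfold AbsRing_ball, abs, minus, plus, opp in hy; simpl in hy.
    rewrite Rabs_right in hy; lra.
  - now exists B.
  - intros; now apply hP.
Qed.

Lemma filter_prod_pos_lt :
  filter_prod (at_right 0) (Rbar_locally p_infty) (fun ab => 0 < fst ab < snd ab).
Proof.
  apply (filter_prod_pos (fun a b => 0 < a < b) (mkposreal 1 Rlt_0_1) 1); simpl.
  intros; lra.
Qed.

Lemma filter_prod_pos_inv (P : R -> R -> Prop) :
  filter_prod (at_right 0) (Rbar_locally p_infty) (fun ab => P (fst ab) (snd ab)) ->
  exists d B, 0 < d /\ forall a b, 0 < a < d -> B < b -> P a b.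
Proof.
  intros [Q S [d hQ] [B hS] hP].
  exists d, B. split; [apply cond_pos|].
  intros a b ha hb. apply (hP a b); [|now apply hS].
  apply hQ; [|lra].
  unfold ball; simpl; unfold AbsRing_ball, abs, minus, plus, opp; simpl.
  rewrite Rabs_right; lra.
Qed.

(** The order [a < b] is offered to the user for free, since the two filters eventually separate the
    endpoints. *)
Lemma is_RInt_pos_intro (f : R -> R) (l : R) :
  (forall x, 0 < x -> continuous f x) ->
  (forall eps, 0 < eps -> exists d B, 0 < d /\
     forall a b, 0 < a < d -> B < b -> a < b -> Rabs (RInt f a b - l) < eps) ->
  is_RInt_pos f l.
Proof.
  intros hf h P [eps hP]. unfold filtermapi.
  destruct (h eps (cond_pos eps)) as [d [B [hd hB]]].
  (* Capping [d] at [1] and raising [B] to at least [1] forces [a < 1 < b]. *)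
  assert (hd' : 0 < Rmin d 1) by (apply Rmin_glb_lt; lra).
  apply (filter_prod_pos (fun a b => exists y, is_RInt f a b y /\ P y)
           (mkposreal _ hd') (Rmax B 1)).
  simpl; intros a b ha hb.
  assert (h1 := Rmin_l d 1). assert (h2 := Rmin_r d 1).
  assert (h3 := Rmax_l B 1). assert (h4 := Rmax_r B 1).
  exists (RInt f a b). split.
  - apply (RInt_correct (V := R_CompleteNormedModule)), ex_RInt_of_continuous_pos; trivial; lra.
  - apply hP. apply hB; lra.
Qed.

Lemma is_RInt_pos_elim (f : R -> R) (l eps : R) :
  is_RInt_pos f l -> 0 < eps ->
  exists d B, 0 < d /\ forall a b, 0 < a < d -> B < b -> Rabs (RInt f a b - l) < eps.
Proof.
  intros h heps.
  specialize (h (ball l (mkposreal _ heps)) (locally_ball _ _)).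
  unfold filtermapi in h.
  destruct (filter_prod_pos_inv
    (fun a b => exists y, is_RInt f a b y /\ ball l (mkposreal _ heps) y) h)
    as [d [B [hd hB]]].
  exists d, B. split; [exact hd|]. intros a b ha hb.
  destruct (hB a b ha hb) as [y [hy1 hy2]].
  rewrite (is_RInt_unique _ _ _ _ hy1). exact hy2.
Qed.

Lemma RInt_pos_mono (f : R -> R) (a b c d : R) :
  (forall x, 0 < x -> continuous f x) -> (forall x, 0 < x -> 0 <= f x) ->
  0 < c -> c <= a -> a <= b -> b <= d -> RInt f a b <= RInt f c d.
Proof.
  intros hf h0 hc hca hab hbd.
  assert (E := fun x y => ex_RInt_of_continuous_pos f x y hf).
  assert (h1 := RInt_Chasles f c a b (E c a ltac:(lra) ltac:(lra)) (E a b ltac:(lra) ltac:(lra))).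
  assert (h2 := RInt_Chasles f c b d (E c b ltac:(lra) ltac:(lra)) (E b d ltac:(lra) ltac:(lra))).
  assert (h3 : 0 <= RInt f c a) by (apply RInt_ge_0; [lra|apply E; lra|intros; apply h0; lra]).
  assert (h4 : 0 <= RInt f b d) by (apply RInt_ge_0; [lra|apply E; lra|intros; apply h0; lra]).
  unfold plus in *; simpl in *; lra.
Qed.

(** A proper integral exceeding [l] would, by positivity, keep every larger interval at least as far
    above [l], against convergence. *)
Lemma RInt_le_is_RInt_pos (f : R -> R) (l a b : R) :
  (forall x, 0 < x -> continuous f x) -> (forall x, 0 < x -> 0 <= f x) ->
  is_RInt_pos f l -> 0 < a -> a <= b -> RInt f a b <= l.
Proof.
  intros hf h0 hl ha hab.
  apply Rnot_lt_le; intros hlt.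
  destruct (is_RInt_pos_elim f l (RInt f a b - l) hl ltac:(lra)) as [d [B [hd hB]]].
  assert (h1 := Rmin_l a (d / 2)). assert (h2 := Rmin_r a (d / 2)).
  assert (h5 : 0 < Rmin a (d / 2)) by (apply Rmin_glb_lt; lra).
  assert (h3 := Rmax_l (B + 1) b). assert (h4 := Rmax_r (B + 1) b).
  specialize (hB (Rmin a (d / 2)) (Rmax (B + 1) b) ltac:(lra) ltac:(lra)).
  assert (h6 := RInt_pos_mono f a b (Rmin a (d / 2)) (Rmax (B + 1) b) hf h0 h5 h1 hab h4).
  rewrite Rabs_right in hB; lra.
Qed.

(** Monotone convergence: the limit is the supremum of the proper integrals, approached on every
    interval that contains a nearly optimal one. *)
Lemma is_RInt_pos_bounded (f : R -> R) (M : R) :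
  (forall x, 0 < x -> continuous f x) -> (forall x, 0 < x -> 0 <= f x) ->
  (forall a b, 0 < a -> a <= b -> RInt f a b <= M) ->
  exists l, is_RInt_pos f l /\ l <= M.
Proof.
  intros hf h0 hM.
  destruct (completeness (fun y => exists a b, 0 < a /\ a <= b /\ y = RInt f a b)) as [l [hub hl]].
  - exists M. intros y [a [b [ha [hab ->]]]]. now apply hM.
  - exists (RInt f 1 1), 1, 1. repeat split; lra.
  - exists l. split; [|apply hl; intros y [a [b [ha [hab ->]]]]; now apply hM].
    apply is_RInt_pos_intro; [exact hf|]. intros eps heps.
    (* Either some interval comes within [eps] of the supremum, or [l - eps] is a smaller upper
       bound. *)
    destruct (Classical_Prop.classic (exists a b, 0 < a /\ a <= b /\ l - eps < RInt f a b))
      as [[a [b [ha [hab h]]]]|hn].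
    + exists a, b. split; [exact ha|]. intros x y hx hy hxy.
      assert (h1 := RInt_pos_mono f a b x y hf h0 ltac:(lra) ltac:(lra) hab ltac:(lra)).
      assert (h2 : RInt f x y <= l) by (apply hub; exists x, y; repeat split; lra).
      apply Rabs_def1; lra.
    + assert (l <= l - eps); [|lra].
      apply hl. intros y [a [b [ha [hab ->]]]].
      apply Rnot_lt_le; intros hlt. apply hn. now exists a, b.
Qed.

Lemma is_RInt_pos_dominated (f g : R -> R) (lg : R) :
  (forall x, 0 < x -> continuous f x) -> (forall x, 0 < x -> continuous g x) ->
  (forall x, 0 < x -> 0 <= f x <= g x) ->
  is_RInt_pos g lg -> exists lf, is_RInt_pos f lf /\ lf <= lg.
Proof.
  intros hf hg hfg hl.
  apply is_RInt_pos_bounded; [exact hf|intros x hx; now apply hfg|].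
  intros a b ha hab. apply Rle_trans with (RInt g a b).
  - apply RInt_le; [exact hab| | |intros x hx; apply hfg; lra];
      apply ex_RInt_of_continuous_pos; trivial; lra.
  - apply RInt_le_is_RInt_pos; trivial.
    intros x hx. destruct (hfg x hx); lra.
Qed.

Lemma is_RInt_pos_unique (f : R -> R) (l l' : R) :
  is_RInt_pos f l -> is_RInt_pos f l' -> l = l'.
Proof.
  intros h h'.
  rewrite <- (is_RInt_gen_unique f l h). now apply is_RInt_gen_unique.
Qed.

Lemma is_RInt_pos_le (f g : R -> R) (lf lg : R) :
  (forall x, 0 < x -> continuous f x) -> (forall x, 0 < x -> continuous g x) ->
  (forall x, 0 < x -> 0 <= f x <= g x) ->
  is_RInt_pos f lf -> is_RInt_pos g lg -> lf <= lg.
Proof.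
  intros hf hg hfg hlf hlg.
  destruct (is_RInt_pos_dominated f g lg hf hg hfg hlg) as [l [hl hle]].
  now rewrite (is_RInt_pos_unique f lf l).
Qed.

Lemma is_RInt_pos_ext (f g : R -> R) (l : R) :
  (forall x, 0 < x -> f x = g x) -> is_RInt_pos f l -> is_RInt_pos g l.
Proof.
  intros hfg. apply is_RInt_gen_ext.
  apply filter_imp with (2 := filter_prod_pos_lt).
  intros [a b] hab x hx; simpl in *. apply hfg.
  rewrite Rmin_left in hx; lra.
Qed.

(** Fundamental theorem of calculus in which [F] need not be defined sensibly at [0]: only its
    one-sided limit enters. *)
Lemma is_RInt_pos_derive (F f : R -> R) (l0 l1 : R) :
  (forall x, 0 < x -> is_derive F x (f x)) -> (forall x, 0 < x -> continuous f x) ->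
  filterlim F (at_right 0) (locally l0) ->
  filterlim F (Rbar_locally p_infty) (locally l1) ->
  is_RInt_pos f (l1 - l0).
Proof.
  intros hF hf h0 h1.
  apply is_RInt_pos_ext with (Derive F).
  { intros x hx. apply is_derive_unique. now apply hF. }
  apply is_RInt_gen_Derive; trivial;
    apply filter_imp with (2 := filter_prod_pos_lt);
    intros [a b] hab x hx; simpl in *; rewrite Rmin_left in hx; try lra.
  - exists (f x). apply hF; lra.
  (* [Derive F] is known to agree with [f] only on the positive half-line, which is a neighbourhood
     of [x]. *)
  - apply continuous_ext_loc with f; [|apply hf; lra].
    apply (locally_interval _ x 0 p_infty); simpl; [lra|trivial|].
    intros y hy _. symmetry. apply is_derive_unique. now apply hF.
Qed.

Lemma is_RInt_pos_comp (f phi dphi : R -> R) (l : R) :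
  (forall x, 0 < x -> continuous f x) ->
  (forall x, 0 < x -> 0 < phi x) ->
  (forall x, 0 < x -> is_derive phi x (dphi x)) ->
  (forall x, 0 < x -> continuous dphi x) ->
  filterlim phi (at_right 0) (at_right 0) ->
  filterlim phi (Rbar_locally p_infty) (Rbar_locally p_infty) ->
  is_RInt_pos f l -> is_RInt_pos (fun x => dphi x * f (phi x)) l.
Proof.
  intros hf hpos hphi hdphi h0 h1 hl P hP. unfold filtermapi.
  specialize (hl P hP). unfold filtermapi in hl.
  destruct hl as [Q S hQ hS hQS].
  assert (h2 : filter_prod (at_right 0) (Rbar_locally p_infty)
                 (fun ab => Q (phi (fst ab)) /\ S (phi (snd ab)))).
  { exists (fun a => Q (phi a)) (fun b => S (phi b)).
    - exact (h0 Q hQ).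
    - exact (h1 S hS).
    - now split. }
  apply filter_imp with (2 := filter_and _ _ h2 filter_prod_pos_lt).
  intros [a b] [[ha hb] hab]; simpl in *.
  destruct (hQS _ _ ha hb) as [y [hy1 hy2]]; simpl in *.
  exists y. split; [|exact hy2].
  rewrite <- (is_RInt_unique _ _ _ _ hy1).
  apply (is_RInt_comp f phi dphi a b); intros x hx; rewrite Rmin_left in hx; try lra.
  - apply hf, hpos; lra.
  - split; [apply hphi|apply hdphi]; lra.
Qed.

(** * Beta and exponential integrals *)

Definition beta_kernel (s b u : R) : R := Rpower u (s - 1) * Rpower (1 + u) (- b).

Lemma beta_kernel_pos (s b u : R) : 0 < beta_kernel s b u.
Proof. apply Rmult_lt_0_compat; apply exp_pos. Qed.

Lemma continuous_beta_kernel (s b u : R) : 0 < u -> continuous (beta_kernel s b) u.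
Proof.
  intros hu. unfold beta_kernel, Rpower.
  apply (ex_derive_continuous (V := R_NormedModule)). auto_derive. lra.
Qed.

(** * Limits of powers at the two ends of the half-line *)

Lemma filterlim_Rpower_0 (p : R) : 0 < p ->
  filterlim (fun u => Rpower u p) (at_right 0) (locally 0).
Proof.
  intros hp. unfold Rpower.
  apply filterlim_comp with (Rbar_locally m_infty); [|exact is_lim_exp_m].
  apply filterlim_comp with (Rbar_locally m_infty); [exact is_lim_ln_0|].
  replace m_infty with (Rbar_mult p m_infty) at 2; [apply filterlim_Rbar_mult_l|].
  now apply is_Rbar_mult_unique, is_Rbar_mult_sym, is_Rbar_mult_m_infty_pos.
Qed.

Lemma filterlim_Rpower_neg_p (p : R) : 0 < p ->
  filterlim (fun u => Rpower u (- p)) (Rbar_locally p_infty) (locally 0).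
Proof.
  intros hp. unfold Rpower.
  apply filterlim_comp with (Rbar_locally m_infty); [|exact is_lim_exp_m].
  apply filterlim_comp with (Rbar_locally p_infty); [exact is_lim_ln_p|].
  replace m_infty with (Rbar_mult (- p) p_infty); [apply filterlim_Rbar_mult_l|].
  apply is_Rbar_mult_unique, is_Rbar_mult_sym, is_Rbar_mult_p_infty_neg. simpl; lra.
Qed.

Lemma filterlim_Rpower_p (p : R) : 0 < p ->
  filterlim (fun u => Rpower u p) (Rbar_locally p_infty) (Rbar_locally p_infty).
Proof.
  intros hp. unfold Rpower.
  apply filterlim_comp with (Rbar_locally p_infty); [|exact is_lim_exp_p].
  apply filterlim_comp with (Rbar_locally p_infty); [exact is_lim_ln_p|].
  replace p_infty with (Rbar_mult p p_infty) at 2; [apply filterlim_Rbar_mult_l|].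
  now apply is_Rbar_mult_unique, is_Rbar_mult_sym, is_Rbar_mult_p_infty_pos.
Qed.

Lemma filterlim_1_plus_p :
  filterlim (Rplus 1) (Rbar_locally p_infty) (Rbar_locally p_infty).
Proof.
  intros P [M hM]. exists M. intros x hx. apply hM. lra.
Qed.

Lemma at_right_0_pos : at_right 0 (fun x => 0 < x).
Proof. exists (mkposreal 1 Rlt_0_1). now intros. Qed.

Lemma filterlim_at_right_0 (phi : R -> R) (F : (R -> Prop) -> Prop) {FF : Filter F} :
  F (fun x => 0 < phi x) ->
  filterlim phi F (locally 0) -> filterlim phi F (at_right 0).
Proof.
  intros hpos h P hP. unfold filtermap.
  specialize (h _ hP). unfold filtermap in h.
  apply filter_imp with (2 := filter_and _ _ hpos h).
  intros x [h1 h2]. now apply h2.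
Qed.

Lemma filterlim_squeeze_0 (F : (R -> Prop) -> Prop) (f g : R -> R) {FF : Filter F} :
  F (fun x => 0 <= f x <= g x) -> filterlim g F (locally 0) -> filterlim f F (locally 0).
Proof.
  intros h hg.
  apply (filterlim_le_le (fun _ => 0) f g 0); [exact h|apply filterlim_const|exact hg].
Qed.

Lemma filterlim_mult_const (F : (R -> Prop) -> Prop) (f : R -> R) (k l l' : R) {FF : Filter F} :
  k * l = l' -> filterlim f F (locally l) -> filterlim (fun x => k * f x) F (locally l').
Proof.
  intros <- h. eapply filterlim_comp; [exact h|].
  exact (filterlim_scal_r (V := R_NormedModule) k l).
Qed.

Lemma p_infty_gt (M : R) : Rbar_locally p_infty (fun x => M < x).
Proof. now exists M. Qed.

(** * Beta integrals: convergence, recurrence and a closed case *)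

(** The product rule leaves a term in [u ^ s (1 + u) ^ (- b - 1)]; writing [u = (1 + u) - 1] splits
    it into the two kernels. *)
Lemma is_derive_beta_primitive (s b u : R) : 0 < u ->
  is_derive (fun u => Rpower u s * Rpower (1 + u) (- b)) u
    ((s - b) * beta_kernel s b u + b * beta_kernel s (b + 1) u).
Proof.
  intros hu. unfold beta_kernel.
  replace (Rpower u (s - 1)) with (Rpower u s / u)
    by (unfold Rminus; rewrite Rpower_plus, Rpower_Ropp, Rpower_1; [reflexivity|lra]).
  replace (Rpower (1 + u) (- (b + 1))) with (Rpower (1 + u) (- b) / (1 + u)).
  2:{ rewrite Ropp_plus_distr, Rpower_plus, (Rpower_Ropp _ 1), Rpower_1; [reflexivity|lra]. }
  unfold Rpower. auto_derive; [lra|]. field. lra.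
Qed.

Lemma beta_kernel_le (s b u : R) : 1 <= s -> 0 < u ->
  0 <= beta_kernel s b u <= Rpower (1 + u) (s - 1 - b).
Proof.
  intros hs hu. split; [apply Rlt_le, beta_kernel_pos|].
  unfold beta_kernel. replace (s - 1 - b) with ((s - 1) + - b) by ring.
  rewrite Rpower_plus. apply Rmult_le_compat_r; [apply Rlt_le, exp_pos|].
  apply Rle_Rpower_l; lra.
Qed.

Lemma continuous_Rpower_1_plus (p u : R) : 0 < u -> continuous (fun u => Rpower (1 + u) p) u.
Proof.
  intros hu. unfold Rpower.
  apply (ex_derive_continuous (V := R_NormedModule)). auto_derive. lra.
Qed.

Lemma is_RInt_pos_Rpower_1_plus (e : R) : 0 < e ->
  is_RInt_pos (fun u => Rpower (1 + u) (- e - 1)) (1 / e).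
Proof.
  intros he.
  replace (1 / e) with (0 - - (1 / e)) by ring.
  apply is_RInt_pos_derive with (fun u => - (1 / e) * Rpower (1 + u) (- e)).
  - intros u hu. unfold Rminus. rewrite Rpower_plus, (Rpower_Ropp _ 1), Rpower_1 by lra.
    unfold Rpower. auto_derive; [lra|]. field. lra.
  - intros u hu. now apply continuous_Rpower_1_plus.
  - assert (hc : continuous (fun u => - (1 / e) * Rpower (1 + u) (- e)) 0).
    { unfold Rpower. apply (ex_derive_continuous (V := R_NormedModule)). auto_derive. lra. }
    unfold continuous in hc.
    replace (- (1 / e) * Rpower (1 + 0) (- e)) with (- (1 / e)) in hc.
    2:{ rewrite Rplus_0_r. unfold Rpower. rewrite ln_1, Rmult_0_r, exp_0. ring. }
    eapply filterlim_filter_le_1; [apply filter_le_within|exact hc].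
  - apply (filterlim_mult_const _ _ _ 0 _); [apply Rmult_0_r|].
    apply filterlim_comp with (2 := filterlim_Rpower_neg_p e he). apply filterlim_1_plus_p.
Qed.

(** As [s >= 1], the factor [u ^ (s - 1)] is at most [(1 + u) ^ (s - 1)], and the resulting power of
    [1 + u] has exponent below [-1]. *)
Lemma ex_beta_int (s b : R) : 1 <= s -> s < b -> exists l, is_RInt_pos (beta_kernel s b) l.
Proof.
  intros hs hb.
  destruct (is_RInt_pos_dominated (beta_kernel s b) (fun u => Rpower (1 + u) (- (b - s) - 1))
    (1 / (b - s))) as [l [hl _]].
  - intros u hu. now apply continuous_beta_kernel.
  - intros u hu. now apply continuous_Rpower_1_plus.
  - intros u hu. replace (- (b - s) - 1) with (s - 1 - b) by ring.
    now apply beta_kernel_le.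
  - apply is_RInt_pos_Rpower_1_plus. lra.
  - now exists l.
Qed.

Lemma filterlim_beta_primitive_0 (s b : R) : 0 < s -> 0 <= b ->
  filterlim (fun u => Rpower u s * Rpower (1 + u) (- b)) (at_right 0) (locally 0).
Proof.
  intros hs hb. apply (filterlim_squeeze_0 _ _ (fun u => Rpower u s)); [|now apply filterlim_Rpower_0].
  apply (filter_imp (F := at_right 0) _ _) with (2 := at_right_0_pos). intros u hu.
  assert (h1 : 0 < Rpower u s) by apply exp_pos.
  assert (h2 : 0 < Rpower (1 + u) (- b)) by apply exp_pos.
  assert (h3 : Rpower (1 + u) (- b) <= 1).
  { apply Rle_trans with (Rpower (1 + u) 0); [apply Rle_Rpower; lra|rewrite Rpower_O; lra]. }
  split; nra.
Qed.

(** The primitive [u ^ s (1 + u) ^ (- b)] vanishes at both ends, so the combination of kernels in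
    its derivative integrates to [0]. *)
Lemma beta_int_rec (s b l : R) : 1 <= s -> s < b ->
  is_RInt_pos (beta_kernel s b) l -> is_RInt_pos (beta_kernel s (b + 1)) ((b - s) / b * l).
Proof.
  intros hs hb hl.
  assert (h : is_RInt_pos (fun u => (s - b) * beta_kernel s b u + b * beta_kernel s (b + 1) u) (0 - 0)).
  { apply is_RInt_pos_derive with (fun u => Rpower u s * Rpower (1 + u) (- b)).
    - intros u hu. now apply is_derive_beta_primitive.
    - intros u hu. unfold beta_kernel, Rpower.
      apply (ex_derive_continuous (V := R_NormedModule)). auto_derive. lra.
    - apply filterlim_beta_primitive_0; lra.
    - apply (filterlim_squeeze_0 _ _ (fun u => Rpower (1 + u) (- (b - s)))).
      + apply filter_imp with (2 := p_infty_gt 0). intros u hu.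
        split; [apply Rlt_le, Rmult_lt_0_compat; apply exp_pos|].
        replace (- (b - s)) with (s + - b) by ring. rewrite Rpower_plus.
        apply Rmult_le_compat_r; [apply Rlt_le, exp_pos|]. apply Rle_Rpower_l; lra.
      + apply filterlim_comp with (2 := filterlim_Rpower_neg_p (b - s) ltac:(lra)).
        apply filterlim_1_plus_p. }
  assert (h2 := is_RInt_gen_plus _ _ _ _ (is_RInt_gen_scal _ (1 / b) _ h)
                  (is_RInt_gen_scal _ ((b - s) / b) _ hl)).
  replace ((b - s) / b * l) with (plus (scal (1 / b) (0 - 0)) (scal ((b - s) / b) l)).
  2:{ unfold plus, scal; simpl; unfold mult; simpl. ring. }
  apply is_RInt_pos_ext with (2 := h2).
  intros u hu. unfold plus, scal; simpl; unfold mult; simpl. field. lra.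
Qed.

(** For [b = s] the first kernel drops out of the derivative formula, leaving the explicit primitive
    [(u / (1 + u)) ^ s / s]. *)
Lemma beta_int_succ (s : R) : 1 <= s -> is_RInt_pos (beta_kernel s (s + 1)) (1 / s).
Proof.
  intros hs.
  replace (1 / s) with (1 / s - 0) by ring.
  apply is_RInt_pos_derive with (fun u => 1 / s * (Rpower u s * Rpower (1 + u) (- s))).
  - intros u hu.
    replace (beta_kernel s (s + 1) u)
      with (1 / s * ((s - s) * beta_kernel s s u + s * beta_kernel s (s + 1) u)) by (field; lra).
    apply (is_derive_scal (fun u => Rpower u s * Rpower (1 + u) (- s))).
    now apply is_derive_beta_primitive.
  - intros u hu. now apply continuous_beta_kernel.
  - apply (filterlim_mult_const _ _ _ 0 _); [apply Rmult_0_r|].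
    apply filterlim_beta_primitive_0; lra.
  - apply (filterlim_mult_const _ _ _ 1 _); [apply Rmult_1_r|].
    (* In the variable [v = / u] the limit at infinity becomes continuity at [v = 0]. *)
    apply filterlim_ext_loc with (fun u => exp (- s * ln (1 + / u))).
    { apply filter_imp with (2 := p_infty_gt 0). intros u hu.
      unfold Rpower. rewrite <- exp_plus. f_equal.
      replace (1 + / u) with ((1 + u) * / u) by (field; lra).
      rewrite ln_mult, ln_Rinv; [ring|lra|lra|now apply Rinv_0_lt_compat]. }
    replace (locally 1) with (locally (exp (- s * ln (1 + 0)))).
    2:{ now rewrite Rplus_0_r, ln_1, Rmult_0_r, exp_0. }
    apply (filterlim_comp _ _ _ Rinv (fun v => exp (- s * ln (1 + v))) _ (locally 0)).
    + apply (filterlim_Rbar_inv p_infty). discriminate.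
    + apply (ex_derive_continuous (V := R_NormedModule)
        (fun v => exp (- s * ln (1 + v)))). auto_derive. lra.
Qed.

(** * Exponential integrals with a rate *)

Definition exp_kernel (s c w : R) : R := Rpower w (s - 1) * exp (- (c * w)).

Lemma continuous_exp_kernel (s c w : R) : 0 < w -> continuous (exp_kernel s c) w.
Proof.
  intros hw. unfold exp_kernel, Rpower.
  apply (ex_derive_continuous (V := R_NormedModule)). auto_derive. lra.
Qed.

Lemma exp_kernel_pos (s c w : R) : 0 < exp_kernel s c w.
Proof. apply Rmult_lt_0_compat; apply exp_pos. Qed.

(** Substitution of [(d / c) w] for [w]; from rate [1] to rate [d] it gives [Gamma s / d ^ s]. *)
Lemma exp_kernel_scale (s c d l : R) : 0 < c -> 0 < d ->
  is_RInt_pos (exp_kernel s c) l -> is_RInt_pos (exp_kernel s d) (Rpower (c / d) s * l).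
Proof.
  intros hc hd hl. pose (r := d / c).
  assert (hr : 0 < r) by (now apply Rdiv_lt_0_compat).
  assert (h : is_RInt_pos (fun w => r * exp_kernel s c (r * w)) l).
  { apply (is_RInt_pos_comp (exp_kernel s c) (fun w => r * w) (fun _ => r)).
    - intros; now apply continuous_exp_kernel.
    - intros; now apply Rmult_lt_0_compat.
    - intros. auto_derive; [trivial|ring].
    - intros. apply continuous_const.
    - apply (filterlim_at_right_0 _ (at_right 0)).
      + apply (filter_imp (F := at_right 0) _ _) with (2 := at_right_0_pos). intros; now apply Rmult_lt_0_compat.
      + eapply filterlim_filter_le_1; [apply filter_le_within|].
        apply (filterlim_mult_const _ _ _ 0 _); [apply Rmult_0_r|apply filterlim_id].
    - replace p_infty with (Rbar_mult r p_infty) at 2; [apply filterlim_Rbar_mult_l|].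
      now apply is_Rbar_mult_unique, is_Rbar_mult_sym, is_Rbar_mult_p_infty_pos.
    - exact hl. }
  apply (is_RInt_gen_scal _ (Rpower (c / d) s)) in h.
  apply is_RInt_pos_ext with (2 := h).
  intros w hw. unfold scal; simpl; unfold mult; simpl.
  unfold exp_kernel. replace (c / d) with (/ r) by (unfold r; field; lra).
  replace (c * (r * w)) with (d * w) by (unfold r; field; lra).
  assert (h1 : Rpower (/ r) s * r * Rpower r (s - 1) = 1).
  { replace r with (Rpower r 1) at 2 by (apply Rpower_1; lra).
    rewrite Rmult_assoc, <- Rpower_plus. unfold Rpower.
    rewrite ln_Rinv, <- exp_plus, <- exp_0 by lra. f_equal. ring. }
  rewrite <- Rpower_mult_distr by lra.
  transitivity (Rpower (/ r) s * r * Rpower r (s - 1) * (Rpower w (s - 1) * exp (- (d * w))));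
    [ring|rewrite h1; ring].
Qed.

(** * Wallis integrals with a cosine weight *)

Definition cos_int (x : R) (n : nat) : R :=
  RInt (fun t => cos (x * t) * cos t ^ n) 0 (PI / 2).

Lemma continuous_cos_int (x : R) (n : nat) (t : R) :
  continuous (fun t => cos (x * t) * cos t ^ n) t.
Proof.
  apply (ex_derive_continuous (V := R_NormedModule)). auto_derive. trivial.
Qed.

Lemma ex_RInt_cos_int (x : R) (n : nat) :
  ex_RInt (fun t => cos (x * t) * cos t ^ n) 0 (PI / 2).
Proof.
  apply (ex_RInt_continuous (V := R_CompleteNormedModule)). intros t _. apply continuous_cos_int.
Qed.

(** The integrand times [1 - x ^ 2] has the primitive [D], whose value is [0] at [0]. Keeping the
    factor on the left avoids excluding [x = 1]. *)
Lemma cos_int_1 (x : R) : (1 - x ^ 2) * cos_int x 1 = cos (x * (PI / 2)).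
Proof.
  pose (D := fun t => cos (x * t) * sin t - x * sin (x * t) * cos t).
  assert (hD : is_RInt (fun t => (1 - x ^ 2) * (cos (x * t) * cos t ^ 1)) 0 (PI / 2)
                 (minus (D (PI / 2)) (D 0))).
  { apply (is_RInt_derive (V := R_CompleteNormedModule)).
    - intros t _. unfold D. auto_derive; [trivial|]. ring.
    - intros t _. apply (continuous_scal_r (1 - x ^ 2) (fun t => cos (x * t) * cos t ^ 1)).
      apply continuous_cos_int. }
  assert (h2 := is_RInt_scal _ _ _ (1 - x ^ 2) _ (RInt_correct _ _ _ (ex_RInt_cos_int x 1))).
  transitivity (minus (D (PI / 2)) (D 0)).
  { rewrite <- (is_RInt_unique _ _ _ _ hD). symmetry. exact (is_RInt_unique _ _ _ _ h2). }
  unfold D, minus, plus, opp; simpl. rewrite cos_PI2, sin_PI2, !Rmult_0_r, sin_0, cos_0. ring.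
Qed.

(** [D] gathers the boundary terms of two integrations by parts. It vanishes at [PI / 2] through the
    powers of [cos] and at [0] through the sines. *)
Lemma cos_int_rec (x : R) (n : nat) :
  ((INR n + 2) ^ 2 - x ^ 2) * cos_int x (n + 2) = (INR n + 2) * (INR n + 1) * cos_int x n.
Proof.
  pose (D := fun t => (INR n + 2) * cos (x * t) * cos t ^ (n + 1) * sin t
                      - x * sin (x * t) * cos t ^ (n + 2)).
  assert (hD : is_RInt (fun t => ((INR n + 2) ^ 2 - x ^ 2) * (cos (x * t) * cos t ^ (n + 2))
                    - (INR n + 2) * (INR n + 1) * (cos (x * t) * cos t ^ n)) 0 (PI / 2)
                 (minus (D (PI / 2)) (D 0))).
  { apply (is_RInt_derive (V := R_CompleteNormedModule)).
    - intros t _. unfold D. auto_derive; [trivial|].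
      replace (Init.Nat.pred (n + 1)) with n by lia.
      replace (Init.Nat.pred (n + 2)) with (n + 1)%nat by lia.
      (* The [match] is the reduced form of [INR (S n)]. *)
      change (match n with O => 1 | S _ => INR n + 1 end) with (INR (S n)).
      rewrite ?plus_INR, ?pow_add. simpl (INR 1). simpl (INR 2).
      assert (hs : sin t * sin t = 1 - cos t * cos t).
      { generalize (sin2_cos2 t); unfold Rsqr; lra. }
      symmetry. transitivity ((INR n + 2) ^ 2 * cos (x * t) * cos t ^ n * cos t ^ 2
        - x ^ 2 * cos (x * t) * cos t ^ n * cos t ^ 2
        - (INR n + 2) * (INR n + 1) * cos (x * t) * cos t ^ n
        ); [ring|].
      transitivity ((INR n + 2) * (cos t ^ n * cos t ^ 2) * cos (x * t)
         - (INR n + 2) * (INR n + 1) * cos (x * t) * cos t ^ n * (sin t * sin t)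
         - x ^ 2 * cos (x * t) * cos t ^ n * cos t ^ 2); [rewrite hs; ring|ring].
    - intros t _. apply (ex_derive_continuous (V := R_NormedModule)). auto_derive. trivial. }
  assert (h2 := fun k => RInt_correct _ _ _ (ex_RInt_cos_int x k)).
  assert (h3 := is_RInt_minus _ _ _ _ _ _
     (is_RInt_scal _ _ _ ((INR n + 2) ^ 2 - x ^ 2) _ (h2 (n + 2)%nat))
     (is_RInt_scal _ _ _ ((INR n + 2) * (INR n + 1)) _ (h2 n))).
  apply Rminus_diag_uniq.
  transitivity (minus (D (PI / 2)) (D 0)).
  - rewrite <- (is_RInt_unique _ _ _ _ hD). symmetry. exact (is_RInt_unique _ _ _ _ h3).
  - unfold D, minus, plus, opp; simpl.
    rewrite cos_PI2, sin_PI2, Rmult_0_r, sin_0, cos_0, !pow_i by lia. ring.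
Qed.

Lemma cos_le_1_bounds (x t : R) : 0 <= x <= 1 -> 0 <= t <= PI / 2 -> cos t <= cos (x * t) <= 1.
Proof.
  intros hx ht. split; [|apply COS_bound].
  assert (hp := PI_RGT_0).
  apply cos_decr_1; nra.
Qed.

(** Since [cos t <= cos (x t) <= 1], the weight costs at most one power of [cos t]; the asymptotics
    thus reduce to the unweighted Wallis integrals [cos_int 0]. *)
Lemma cos_int_0_le (x : R) (n : nat) : 0 <= x <= 1 ->
  cos_int 0 (n + 1) <= cos_int x n <= cos_int 0 n.
Proof.
  intros hx. assert (hp := PI_RGT_0).
  split; (apply RInt_le; [lra|apply ex_RInt_cos_int|apply ex_RInt_cos_int|]);
    intros t ht; rewrite Rmult_0_l, cos_0;
    destruct (cos_le_1_bounds x t hx ltac:(lra)) as [h1 h2];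
    assert (h3 : 0 <= cos t ^ n) by (apply pow_le, cos_ge_0; lra).
  - rewrite pow_add; simpl. nra.
  - nra.
Qed.

(** The recurrence at [x = 0] makes the left side independent of [n]; at [n = 0] the two integrals
    are [PI / 2] and [1]. *)
Lemma wallis (n : nat) : (INR n + 1) * cos_int 0 n * cos_int 0 (n + 1) = PI / 2.
Proof.
  induction n as [|n IH].
  - assert (h1 := cos_int_1 0). rewrite Rmult_0_l, cos_0 in h1.
    assert (h0 : cos_int 0 0 = PI / 2).
    { unfold cos_int. rewrite (RInt_ext _ (fun _ => 1)).
      - rewrite RInt_const. unfold scal; simpl; unfold mult; simpl. ring.
      - intros t _. rewrite Rmult_0_l, cos_0; simpl. ring. }
    simpl (0 + 1)%nat. rewrite h0. replace (cos_int 0 1) with 1 by lra. simpl. ring.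
  - rewrite <- IH, S_INR. assert (h := cos_int_rec 0 n).
    replace (S n + 1)%nat with (n + 2)%nat by lia.
    replace (S n) with (n + 1)%nat by lia.
    assert (hn := pos_INR n).
    replace (cos_int 0 (n + 2)) with ((INR n + 1) / (INR n + 2) * cos_int 0 n).
    + field. lra.
    + apply Rmult_eq_reg_l with ((INR n + 2) ^ 2 - 0 ^ 2); [|nra].
      rewrite h. field. lra.
Qed.

(** With [W_k] for [cos_int 0 k], which decreases in [k], the square lies between
    [W_(n + 2) W_(n + 3)] and [W_n W_(n + 1)], both known from [wallis]. *)
Lemma cos_int_sqr_bounds (x : R) (n : nat) : 0 <= x <= 1 -> 0 <= cos_int x (n + 1) /\
  PI / 2 / (INR n + 3) <= cos_int x (n + 1) ^ 2 <= PI / 2 / (INR n + 1).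
Proof.
  intros hx. assert (hn := pos_INR n). assert (hp := PI_RGT_0).
  assert (W0 : forall k, 0 <= cos_int 0 k).
  { intros k. apply RInt_ge_0; [lra|apply ex_RInt_cos_int|].
    intros t ht. rewrite Rmult_0_l, cos_0, Rmult_1_l. apply pow_le, cos_ge_0; lra. }
  assert (Wd : forall k, cos_int 0 (k + 1) <= cos_int 0 k)
    by (intros k; apply (cos_int_0_le 0 k); lra).
  destruct (cos_int_0_le x (n + 1) hx) as [h1 h2].
  assert (w0 := wallis n). assert (w2 := wallis (n + 2)).
  rewrite plus_INR in w2; simpl (INR 2) in w2.
  assert (d0 := Wd n). assert (d2 := Wd (n + 2)%nat).
  replace (n + 1 + 1)%nat with (n + 2)%nat in * by lia.
  assert (p0 := W0 n). assert (p1 := W0 (n + 1)%nat). assert (p2 := W0 (n + 2)%nat).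
  assert (p3 := W0 (n + 2 + 1)%nat).
  split; [lra|].
  replace (PI / 2 / (INR n + 3)) with (cos_int 0 (n + 2) * cos_int 0 (n + 2 + 1))
    by (rewrite <- w2; field; lra).
  replace (PI / 2 / (INR n + 1)) with (cos_int 0 n * cos_int 0 (n + 1))
    by (rewrite <- w0; field; lra).
  split; nra.
Qed.

Lemma cos_int_odd_lim (x : R) : 0 <= x <= 1 ->
  is_lim_seq (fun n => sqrt (INR n) * cos_int x (2 * n + 1)) (sqrt PI / 2).
Proof.
  intros hx. assert (hp := PI_RGT_0).
  apply is_lim_seq_ext with (fun n => sqrt (INR n * cos_int x (2 * n + 1) ^ 2)).
  { intros n. destruct (cos_int_sqr_bounds x (2 * n) hx) as [h0 _].
    rewrite sqrt_mult; [|apply pos_INR|apply pow2_ge_0]. now rewrite sqrt_pow2. }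
  replace (sqrt PI / 2) with (sqrt (PI / 4)).
  2:{ replace 4 with (2 ^ 2) by ring. rewrite sqrt_div, sqrt_pow2; lra. }
  apply is_lim_seq_continuous.
  { apply continuity_pt_sqrt. lra. }
  (* Both bounds on [n] times the square take this form, with [c = 3] below and [c = 1] above. *)
  assert (hl : forall c, 0 < c -> is_lim_seq (fun n => PI / 2 / (2 + c * / INR n)) (PI / 4)).
  { intros c hc. replace (Finite (PI / 4)) with (Rbar_div (PI / 2) (Finite (2 + c * 0))).
    2:{ simpl. f_equal. field. }
    apply is_lim_seq_div'; [apply is_lim_seq_const| |lra].
    apply is_lim_seq_plus'; [apply is_lim_seq_const|].
    apply is_lim_seq_mult'; [apply is_lim_seq_const|].
    apply (is_lim_seq_inv INR p_infty); [apply is_lim_seq_INR|discriminate]. }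
  apply is_lim_seq_le_le_loc with (3 := hl 1 Rlt_0_1) (2 := hl 3 ltac:(lra)).
  exists 1%nat. intros n hn. apply le_INR in hn; simpl in hn.
  destruct (cos_int_sqr_bounds x (2 * n) hx) as [_ [h1 h2]].
  rewrite mult_INR in h1, h2; replace (INR 2) with 2 in h1, h2 by (simpl; ring).
  replace (PI / 2 / (2 + 3 * / INR n)) with (INR n * (PI / 2 / (2 * INR n + 3))) by (field; repeat split; lra).
  replace (PI / 2 / (2 + 1 * / INR n)) with (INR n * (PI / 2 / (2 * INR n + 1))) by (field; repeat split; lra).
  split; apply Rmult_le_compat_l; lra.
Qed.

(** * Comparison of beta integrals with Gamma *)

(** Under [u = exp w - 1] the factor [(1 + u) ^ (- b)] becomes [exp (- b w)], and the Jacobian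
    [exp w] lowers the rate to [b - 1]. *)
Lemma beta_int_exp_subst (s b l : R) :
  is_RInt_pos (beta_kernel s b) l ->
  is_RInt_pos (fun w => Rpower (exp w - 1) (s - 1) * exp (- ((b - 1) * w))) l.
Proof.
  intros hl.
  assert (hpos : forall w, 0 < w -> 0 < exp w - 1).
  { intros w hw. assert (h := exp_ineq1 w). lra. }
  apply (is_RInt_pos_comp _ (fun w => exp w - 1) exp) in hl.
  - apply is_RInt_pos_ext with (2 := hl). intros w hw. unfold beta_kernel.
    replace (1 + (exp w - 1)) with (exp w) by ring.
    unfold Rpower at 2. rewrite ln_exp.
    rewrite (Rmult_comm (exp w)), Rmult_assoc, <- exp_plus. f_equal. f_equal. ring.
  - intros; now apply continuous_beta_kernel.
  - exact hpos.
  - intros w _. auto_derive; [trivial|ring].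
  - intros w _. apply continuous_exp.
  - apply (filterlim_at_right_0 _ (at_right 0)).
    + apply (filter_imp (F := at_right 0) _ _) with (2 := at_right_0_pos). exact hpos.
    + eapply filterlim_filter_le_1; [apply filter_le_within|].
      assert (hc : continuous (fun w => exp w - 1) 0).
      { apply (ex_derive_continuous (V := R_NormedModule)). auto_derive. trivial. }
      unfold continuous in hc. rewrite exp_0, Rminus_diag in hc. exact hc.
  - intros P [M hM]. exists M. intros w hw. apply hM.
    assert (h := exp_ineq1_le w). lra.
Qed.

Lemma exp_sub_1_le (w : R) : exp w - 1 <= w * exp w.
Proof.
  (* Multiply [1 - w <= exp (- w)] by [exp w]. *)
  assert (h := exp_ineq1_le (- w)). assert (h1 : exp w * exp (- w) = 1).
  { rewrite <- exp_plus, Rplus_opp_r. apply exp_0. }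
  assert (h2 := exp_pos w). nra.
Qed.

(** Raise [w <= exp w - 1 <= w exp w] to the power [s - 1 >= 0]; on the right, [exp ((s - 1) w)] is
    absorbed and turns the rate [b - 1] into [b - s]. *)
Lemma exp_sub_1_Rpower_bounds (s b w : R) : 1 <= s -> 0 < w ->
  0 <= exp_kernel s (b - 1) w <= Rpower (exp w - 1) (s - 1) * exp (- ((b - 1) * w)) /\
  Rpower (exp w - 1) (s - 1) * exp (- ((b - 1) * w)) <= exp_kernel s (b - s) w.
Proof.
  intros hs hw. assert (h1 := exp_ineq1_le w). assert (h2 := exp_sub_1_le w).
  split; [split; [apply Rlt_le, exp_kernel_pos|]|]; unfold exp_kernel.
  - apply Rmult_le_compat_r; [apply Rlt_le, exp_pos|]. apply Rle_Rpower_l; lra.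
  - replace (exp (- ((b - s) * w))) with (Rpower (exp w) (s - 1) * exp (- ((b - 1) * w))).
    2:{ unfold Rpower. rewrite ln_exp, <- exp_plus. f_equal. ring. }
    rewrite <- Rmult_assoc, Rpower_mult_distr by (try apply exp_pos; lra).
    apply Rmult_le_compat_r; [apply Rlt_le, exp_pos|]. apply Rle_Rpower_l; [lra|].
    split; [|exact h2]. assert (h3 := exp_ineq1 w). lra.
Qed.

(** [Gamma] is a total function, so convergence has to be proved. It follows from the beta integral
    with [b = s + 1], which is known to converge and dominates the exponential kernel of rate [s];
    rescaling then brings the rate to [1]. *)
Lemma Gamma_correct (s : R) : 1 <= s -> is_RInt_pos (exp_kernel s 1) (Gamma s).
Proof.
  intros hs.
  destruct (is_RInt_pos_dominated (exp_kernel s s)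
     (fun w => Rpower (exp w - 1) (s - 1) * exp (- ((s + 1 - 1) * w))) (1 / s)) as [l [hl _]].
  - intros; now apply continuous_exp_kernel.
  - intros w hw. unfold Rpower. apply (ex_derive_continuous (V := R_NormedModule)).
    auto_derive. assert (h := exp_ineq1 w). lra.
  - intros w hw. destruct (exp_sub_1_Rpower_bounds s (s + 1) w hs hw) as [h _].
    replace (exp_kernel s s w) with (exp_kernel s (s + 1 - 1) w) by (f_equal; ring). exact h.
  - apply beta_int_exp_subst. now apply beta_int_succ.
  - apply (exp_kernel_scale s s 1) in hl; [|lra|lra].
    assert (hl' : is_RInt_pos (fun t => Rpower t (s - 1) * exp (- t)) (Rpower (s / 1) s * l)).
    { apply is_RInt_pos_ext with (2 := hl). intros w _. unfold exp_kernel.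
      now rewrite Rmult_1_l. }
    unfold Gamma. rewrite (is_RInt_gen_unique _ _ hl'). exact hl.
Qed.

Lemma beta_int_Gamma_bounds (s b l : R) : 1 <= s -> s < b ->
  is_RInt_pos (beta_kernel s b) l ->
  Rpower (1 / (b - 1)) s * Gamma s <= l <= Rpower (1 / (b - s)) s * Gamma s.
Proof.
  intros hs hb hl. apply beta_int_exp_subst in hl.
  assert (hc : forall w, 0 < w ->
    continuous (fun w => Rpower (exp w - 1) (s - 1) * exp (- ((b - 1) * w))) w).
  { intros w hw. unfold Rpower. apply (ex_derive_continuous (V := R_NormedModule)).
    auto_derive. assert (h := exp_ineq1 w). lra. }
  assert (hk := fun c (hc : 0 < c) => exp_kernel_scale s 1 c _ Rlt_0_1 hc (Gamma_correct s hs)).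
  split.
  - apply is_RInt_pos_le with (5 := hl) (4 := hk (b - 1) ltac:(lra)); trivial.
    + intros; now apply continuous_exp_kernel.
    + intros w hw. now apply exp_sub_1_Rpower_bounds.
  - apply is_RInt_pos_le with (4 := hl) (5 := hk (b - s) ltac:(lra)); trivial.
    + intros; now apply continuous_exp_kernel.
    + intros w hw. destruct (exp_sub_1_Rpower_bounds s b w hs hw). split; [lra|trivial].
Qed.

(** The upper bound at [b = s + 1] puts the positive value [1 / s] below a positive multiple of
    [Gamma s]. *)
Lemma Gamma_pos (s : R) : 1 <= s -> 0 < Gamma s.
Proof.
  intros hs.
  destruct (beta_int_Gamma_bounds s (s + 1) _ hs ltac:(lra) (beta_int_succ s hs)) as [_ h].
  assert (h1 : 0 < 1 / s) by (apply Rdiv_lt_0_compat; lra).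
  assert (h2 : 0 < Rpower (1 / (s + 1 - s)) s) by apply exp_pos. nra.
Qed.

Lemma is_lim_seq_Rpower_shift (s c : R) : 0 < s ->
  is_lim_seq (fun n => Rpower (INR n) s * Rpower (1 / (INR n + c)) s) 1.
Proof.
  intros hs.
  assert (h0 : is_lim_seq (fun n => / INR n) 0).
  { apply (is_lim_seq_inv INR p_infty); [apply is_lim_seq_INR|discriminate]. }
  apply is_lim_seq_ext_loc with (fun n => exp (- s * ln (1 + c * / INR n))).
  (* Beyond [Rabs c] both [INR n] and [INR n + c] are positive, so the logarithms are genuine. *)
  - destruct (nfloor_ex (Rabs c) (Rabs_pos c)) as [N [_ hN]].
    exists (S N). intros n hn. apply le_INR in hn. rewrite S_INR in hn.
    assert (h1 := pos_INR N). assert (h2 := Rle_abs (- c)). rewrite Rabs_Ropp in h2.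
    unfold Rpower. rewrite <- exp_plus. f_equal.
    replace (1 + c * / INR n) with ((INR n + c) * / INR n) by (field; lra).
    unfold Rdiv. rewrite Rmult_1_l, ln_mult, !ln_Rinv by (try apply Rinv_0_lt_compat; lra). ring.
  - replace (Finite 1) with (Finite (exp (- s * ln (1 + c * 0)))).
    2:{ now rewrite Rmult_0_r, Rplus_0_r, ln_1, Rmult_0_r, exp_0. }
    apply (is_lim_seq_continuous (fun v => exp (- s * ln (1 + c * v)))); [|exact h0].
    apply continuity_pt_filterlim.
    apply (ex_derive_continuous (V := R_NormedModule)
      (fun v => exp (- s * ln (1 + c * v)))). auto_derive. lra.
Qed.

(** Both Gamma bounds are shifted powers of [n], and a fixed shift disappears in the limit. *)
Lemma beta_int_lim (s c : R) (B : nat -> R) : 1 <= s -> s < c ->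
  (forall n, is_RInt_pos (beta_kernel s (c + INR n)) (B n)) ->
  is_lim_seq (fun n => Rpower (INR n) s * B n) (Gamma s).
Proof.
  intros hs hc hB.
  assert (hl : forall d, is_lim_seq
     (fun n => (Rpower (INR n) s * Rpower (1 / (INR n + d)) s) * Gamma s) (Gamma s)).
  { intros d. replace (Finite (Gamma s)) with (Finite (1 * Gamma s)) by (f_equal; ring).
    apply is_lim_seq_mult'; [apply is_lim_seq_Rpower_shift; lra|apply is_lim_seq_const]. }
  apply is_lim_seq_le_le with (2 := hl (c - 1)) (3 := hl (c - s)).
  intros n.
  destruct (beta_int_Gamma_bounds s (c + INR n) (B n) hs ltac:(generalize (pos_INR n); lra) (hB n))
    as [h1 h2].
  replace (c + INR n - 1) with (INR n + (c - 1)) in h1 by ring.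
  replace (c + INR n - s) with (INR n + (c - s)) in h2 by ring.
  (* [Rpower] is an exponential, hence positive even at [n = 0], so the squeeze holds for every
     [n]. *)
  assert (h : 0 < Rpower (INR n) s) by apply exp_pos.
  rewrite !Rmult_assoc. split; apply Rmult_le_compat_l; lra.
Qed.

(** * Evaluation *)

Lemma beta_int_seq (s b l : R) : 1 <= s -> s < b -> is_RInt_pos (beta_kernel s b) l ->
  exists B : nat -> R, B O = l /\
    (forall n, is_RInt_pos (beta_kernel s (b + INR n)) (B n)) /\
    (forall n, B (S n) = (b + INR n - s) / (b + INR n) * B n).
Proof.
  intros hs hb hl.
  exists (nat_rect (fun _ => R) l (fun n y => (b + INR n - s) / (b + INR n) * y)).
  split; [reflexivity|split; [|reflexivity]].
  induction n as [|n IH].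
  - simpl INR. now rewrite Rplus_0_r.
  - rewrite S_INR, <- Rplus_assoc. apply beta_int_rec; [exact hs| |exact IH].
    assert (hn := pos_INR n). lra.
Qed.

Lemma beta_int_value (a l : R) : 0 < a -> a < 1 / 2 ->
  is_RInt_pos (beta_kernel (1 + a) (3 / 2)) l ->
  l / (4 * (1 / 2 + a)) = sqrt PI / (2 * cos (PI * a)) * (Gamma (1 + a) / Gamma (3 / 2 + a)).
Proof.
  intros ha ha2 hl.
  destruct (beta_int_seq (1 + a) (3 / 2) l ltac:(lra) ltac:(lra) hl) as [P [P0 [hP PS]]].
  (* The sequence [Q] starts at [b = s + 1], the case with the closed value [1 / s]. *)
  destruct (beta_int_seq (3 / 2 + a) (3 / 2 + a + 1) _ ltac:(lra) ltac:(lra)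
    (beta_int_succ (3 / 2 + a) ltac:(lra))) as [Q [Q0 [hQ QS]]].
  assert (limP := beta_int_lim (1 + a) (3 / 2) P ltac:(lra) ltac:(lra) hP).
  assert (limQ := beta_int_lim (3 / 2 + a) (3 / 2 + a + 1) Q ltac:(lra) ltac:(lra) hQ).
  assert (limC := cos_int_odd_lim (2 * a) ltac:(lra)).
  assert (G1 := Gamma_pos (1 + a) ltac:(lra)).
  assert (G2 := Gamma_pos (3 / 2 + a) ltac:(lra)).
  assert (hcos : 0 < cos (PI * a)) by (assert (hp := PI_RGT_0); assert (hp2 := Rmult_lt_compat_l PI _ _ hp ha2);
        assert (hp3 := Rmult_lt_0_compat _ _ hp ha); apply cos_gt_0; lra).
  assert (Qpos : forall n, 0 < Q n).
  { induction n as [|n IH].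
    - rewrite Q0. apply Rdiv_lt_0_compat; lra.
    - rewrite QS. assert (hn := pos_INR n). apply Rmult_lt_0_compat; [|exact IH].
      apply Rdiv_lt_0_compat; lra. }
  pose (C := fun n => cos_int (2 * a) (2 * n + 1)).
  assert (CS : forall n, C (S n) =
    (INR n + 1) * (INR n + 3 / 2) / ((INR n + 3 / 2) ^ 2 - a ^ 2) * C n).
  { intros n. assert (hn := pos_INR n). assert (h := cos_int_rec (2 * a) (2 * n + 1)).
    rewrite plus_INR, mult_INR in h. replace (INR 2) with 2 in h by (simpl; ring).
    simpl (INR 1) in h. unfold C. replace (2 * S n + 1)%nat with (2 * n + 1 + 2)%nat by lia.
    assert (hne : (INR n + 3 / 2) ^ 2 - a ^ 2 <> 0) by nra.
    apply Rmult_eq_reg_l with ((2 * INR n + 1 + 2) ^ 2 - (2 * a) ^ 2); [|nra].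
    rewrite h. field. nra. }
  (* The denominator in [CS] is [(n + 3/2 - a) (n + 3/2 + a)]; the rational factor here telescopes
     against it and against what the steps of [P] and [Q] leave. At [n = 0] the value of [C] is
     [cos (PI a) / (1 - 4 a ^ 2)]. *)
  assert (inv : forall n, P n * C n * (INR n + 1 / 2 - a) / (Q n * (INR n + 3 / 2 + a))
                          = l / (4 * (1 / 2 + a)) * cos (PI * a)).
  { induction n as [|n IH].
    - assert (h := cos_int_1 (2 * a)). replace (2 * a * (PI / 2)) with (PI * a) in h by field.
      rewrite P0, Q0, <- h. unfold C. simpl INR. simpl (2 * 0 + 1)%nat. field. lra.
    - rewrite <- IH. assert (hn := pos_INR n). assert (hq := Qpos n).
      rewrite PS, QS, CS, S_INR. field. repeat split; nra. }
  (* The invariant again, with growth rates inserted: [n ^ (1 + a)] for [P] and [n ^ (1 / 2)] for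
     [C] balance [n ^ (3 / 2 + a)] for [Q], and the rational factor is written as [1] minus a null
     term. *)
  assert (lim : is_lim_seq
    (fun n => Rpower (INR n) (1 + a) * P n * (sqrt (INR n) * C n) * (1 - (1 + 2 * a) * / (INR n + (3 / 2 + a)))
              / (Rpower (INR n) (3 / 2 + a) * Q n))
    (Gamma (1 + a) * (sqrt PI / 2) * (1 - (1 + 2 * a) * 0) / Gamma (3 / 2 + a))).
  { apply is_lim_seq_div'; [|exact limQ|lra].
    apply is_lim_seq_mult'; [apply is_lim_seq_mult'; [exact limP|exact limC]|].
    apply is_lim_seq_minus'; [apply is_lim_seq_const|].
    apply is_lim_seq_mult'; [apply is_lim_seq_const|].
    apply (is_lim_seq_inv (fun n => INR n + (3 / 2 + a)) p_infty); [|discriminate].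
    apply (is_lim_seq_plus INR (fun _ => 3 / 2 + a) p_infty (3 / 2 + a));
      [apply is_lim_seq_INR|apply is_lim_seq_const|reflexivity]. }
  assert (E : l / (4 * (1 / 2 + a)) * cos (PI * a)
              = Gamma (1 + a) * (sqrt PI / 2) * (1 - (1 + 2 * a) * 0) / Gamma (3 / 2 + a)).
  { assert (lim' := is_lim_seq_const (l / (4 * (1 / 2 + a)) * cos (PI * a))).
    apply is_lim_seq_ext_loc with (v := fun _ => l / (4 * (1 / 2 + a)) * cos (PI * a)) in lim.
    - apply is_lim_seq_unique in lim, lim'. rewrite lim in lim'. now injection lim'.
    (* From [n = 1] on, [sqrt (INR n)] is the power of exponent [1 / 2] and is nonzero. *)
    - exists 1%nat. intros n hn. apply le_INR in hn; simpl in hn.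
      rewrite <- (inv n). assert (hq := Qpos n).
      assert (h3 : Rpower (INR n) (3 / 2 + a) = Rpower (INR n) (1 + a) * sqrt (INR n)).
      { rewrite <- Rpower_sqrt, <- Rpower_plus by lra. f_equal. field. }
      rewrite h3.
      assert (h1 : 0 < Rpower (INR n) (1 + a)) by apply exp_pos.
      assert (h2 : 0 < sqrt (INR n)) by (apply sqrt_lt_R0; lra).
      field. repeat split; lra. }
  apply Rmult_eq_reg_r with (cos (PI * a)); [|lra].
  rewrite E. field. lra.
Qed.

(** * Integration by parts and reduction to a beta integral *)

(* Collects the boundary terms of both integrations by parts for [c = m / 2]: first against
   [dt], then against [t ^ c dt]. *)
Definition parts_boundary (c t : R) : R :=
  let y := Rpower t c in
  t * (sqrt (1 + y ^ 2) - y) + c / (c + 1) * (t * y * (1 - y / sqrt (1 + y ^ 2))).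

Lemma Rpower_double (t c : R) : Rpower t (2 * c) = Rpower t c ^ 2.
Proof. replace (2 * c) with (c + c) by ring. rewrite Rpower_plus. ring. Qed.

(** Put [y = t ^ c] and [q = sqrt (1 + y ^ 2)], so [t y' = c y]. The first summand contributes
    [q - y - c y (1 - y / q)]; the coefficient [c / (c + 1)] is chosen so that the second cancels
    the last term, leaving only the multiple of [y ^ 2 / q ^ 3]. *)
Lemma is_derive_parts_boundary (c t : R) : 0 < c -> 0 < t ->
  is_derive (parts_boundary c) t
    (sqrt (1 + Rpower t (2 * c)) - Rpower t c
     - c ^ 2 / (c + 1) * (Rpower t (2 * c) * Rpower (1 + Rpower t (2 * c)) (- (3 / 2)))).
Proof.
  intros hc ht. rewrite Rpower_double.
  assert (hy : 0 < Rpower t c) by apply exp_pos.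
  assert (hs : 0 < 1 + Rpower t c ^ 2) by nra.
  replace (Rpower (1 + Rpower t c ^ 2) (- (3 / 2)))
    with (/ (sqrt (1 + Rpower t c ^ 2) ^ 3)).
  2:{ replace (- (3 / 2)) with (- ((/ 2) * INR 3)) by (simpl; field).
      rewrite Rpower_Ropp, <- Rpower_mult, Rpower_sqrt, Rpower_pow by
        (try apply sqrt_lt_R0; lra). reflexivity. }
  unfold parts_boundary.
  assert (hq := sqrt_lt_R0 _ hs).
  assert (hqq := sqrt_sqrt _ (Rlt_le _ _ hs)).
  unfold Rpower in *. auto_derive.
  - repeat split; try lra. apply Rgt_not_eq.
    replace (exp (c * ln t) * (exp (c * ln t) * 1)) with (exp (c * ln t) ^ 2) by ring. exact hq.
  - replace (exp (c * ln t) * (exp (c * ln t) * 1)) with (exp (c * ln t) ^ 2) by ring.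
    set (y := exp (c * ln t)) in *. set (q := sqrt (1 + y ^ 2)) in *.
    assert (hy2 : y ^ 2 = q ^ 2 - 1) by lra.
    (* Once denominators are cleared, eliminating [y ^ 2 = q ^ 2 - 1] leaves a polynomial
       identity. *)
    field_simplify_eq; [|repeat split; lra].
    replace (y ^ 4) with ((q ^ 2 - 1) ^ 2) by (rewrite <- hy2; ring).
    replace (y ^ 3) with ((q ^ 2 - 1) * y) by (rewrite <- hy2; ring).
    rewrite ?hy2. ring.
Qed.

(** The second summand is at most the first, because [y (1 - y / q) = (y / q) (q - y)] and both
    [y / q] and [c / (c + 1)] lie in the unit interval. *)
Lemma parts_boundary_bounds (c t : R) : 0 < c -> 0 < t ->
  0 <= parts_boundary c t <= 2 * (t * (sqrt (1 + Rpower t c ^ 2) - Rpower t c)).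
Proof.
  intros hc ht. unfold parts_boundary.
  assert (hy : 0 < Rpower t c) by apply exp_pos.
  set (y := Rpower t c) in *.
  assert (hs : 0 < 1 + y ^ 2) by nra.
  assert (hq := sqrt_lt_R0 _ hs). assert (hqq := sqrt_sqrt _ (Rlt_le _ _ hs)).
  set (q := sqrt (1 + y ^ 2)) in *.
  assert (hyq : y < q) by nra.
  assert (h1 : 0 <= y * (1 - y / q) <= q - y).
  { replace (y * (1 - y / q)) with (y / q * (q - y)) by (field; lra).
    assert (0 <= y / q) by (apply Rlt_le, Rdiv_lt_0_compat; lra).
    assert (y / q <= 1) by (apply Rmult_le_reg_r with q; [lra|field_simplify; lra]).
    split; nra. }
  assert (h2 : 0 <= c / (c + 1)) by (apply Rlt_le, Rdiv_lt_0_compat; lra).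
  assert (h3 : c / (c + 1) <= 1) by (apply Rmult_le_reg_r with (c + 1); [lra|field_simplify; lra]).
  rewrite (Rmult_assoc t).
  set (z := y * (1 - y / q)) in *. set (k := c / (c + 1)) in *.
  assert (h4 : 0 <= t * z <= t * (q - y)) by (split; nra).
  split; nra.
Qed.

Lemma parts_boundary_0 (c : R) : 0 < c ->
  filterlim (parts_boundary c) (at_right 0) (locally 0).
Proof.
  intros hc. apply (filterlim_squeeze_0 _ _ (fun t => 2 * t)).
  - apply (filter_imp (F := at_right 0) _ _) with (2 := at_right_0_pos). intros t ht.
    destruct (parts_boundary_bounds c t hc ht) as [h1 h2]. split; [exact h1|].
    assert (hy : 0 < Rpower t c) by apply exp_pos. set (y := Rpower t c) in *.
    assert (hs : 0 < 1 + y ^ 2) by nra.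
    assert (hq := sqrt_lt_R0 _ hs). assert (hqq := sqrt_sqrt _ (Rlt_le _ _ hs)).
    set (q := sqrt (1 + y ^ 2)) in *. assert (q - y <= 1) by nra. nra.
  - eapply filterlim_filter_le_1; [apply filter_le_within|].
    apply (filterlim_mult_const _ _ _ 0 _); [apply Rmult_0_r|apply filterlim_id].
Qed.

Lemma parts_boundary_p (c : R) : 1 < c ->
  filterlim (parts_boundary c) (Rbar_locally p_infty) (locally 0).
Proof.
  intros hc. apply (filterlim_squeeze_0 _ _ (fun t => Rpower t (- (c - 1)))).
  - apply filter_imp with (2 := p_infty_gt 0). intros t ht.
    destruct (parts_boundary_bounds c t ltac:(lra) ht) as [h1 h2]. split; [exact h1|].
    replace (- (c - 1)) with (1 + - c) by ring. rewrite Rpower_plus, Rpower_Ropp, Rpower_1 by lra.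
    assert (hy : 0 < Rpower t c) by apply exp_pos. set (y := Rpower t c) in *.
    assert (hs : 0 < 1 + y ^ 2) by nra.
    assert (hq := sqrt_lt_R0 _ hs). assert (hqq := sqrt_sqrt _ (Rlt_le _ _ hs)).
    set (q := sqrt (1 + y ^ 2)) in *. assert (hyq : y < q) by nra.
    (* Here [q - y = 1 / (q + y)] and [q > y]. The boundary term is then at most [t / y], which
       decays because [c > 1]. *)
    assert (h3 : 2 * (q - y) <= / y).
    { apply Rmult_le_reg_r with y; [lra|]. rewrite Rinv_l by lra. nra. }
    nra.
  - apply filterlim_Rpower_neg_p. lra.
Qed.

(** Under [u = t ^ (2 c)] the factor [u ^ (1 / (2 c)) = t] cancels the [1 / t] of the Jacobian
    [2 c t ^ (2 c) / t]. *)
Lemma beta_int_power_subst (c l : R) : 0 < c ->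
  is_RInt_pos (beta_kernel (1 + 1 / (2 * c)) (3 / 2)) l ->
  is_RInt_pos (fun t => Rpower t (2 * c) * Rpower (1 + Rpower t (2 * c)) (- (3 / 2))) (l / (2 * c)).
Proof.
  intros hc hl.
  apply (is_RInt_pos_comp _ (fun t => Rpower t (2 * c)) (fun t => 2 * c * Rpower t (2 * c) / t)) in hl.
  - apply (is_RInt_gen_scal _ (/ (2 * c))) in hl.
    replace (l / (2 * c)) with (scal (/ (2 * c)) l)
      by (unfold scal; simpl; unfold mult; simpl; field; lra).
    apply is_RInt_pos_ext with (2 := hl). intros t ht.
    unfold scal; simpl; unfold mult; simpl. unfold beta_kernel. rewrite Rpower_mult.
    replace (2 * c * (1 + 1 / (2 * c) - 1)) with 1 by (field; lra).
    rewrite Rpower_1 by lra. field. lra.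
  - intros; now apply continuous_beta_kernel.
  - intros; apply exp_pos.
  - intros t ht. unfold Rpower. auto_derive; [lra|]. field. lra.
  - intros t ht. unfold Rpower. apply (ex_derive_continuous (V := R_NormedModule)).
    auto_derive. lra.
  - apply (filterlim_at_right_0 _ (at_right 0)).
    + apply (filter_imp (F := at_right 0) _ _) with (2 := at_right_0_pos). intros; apply exp_pos.
    + apply filterlim_Rpower_0. lra.
  - apply filterlim_Rpower_p. lra.
Qed.

Theorem theoremA1 (m : nat) (hm : (3 <= m)%nat) :
  is_RInt_gen
    (fun t => sqrt (1 + Rpower t (INR m)) - Rpower t (INR m / 2))
    (at_right 0) (Rbar_locally p_infty)
    (sqrt PI / (2 * cos (PI / INR m))
       * (Gamma (1 + 1 / INR m) / Gamma (3 / 2 + 1 / INR m))).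
Proof.
  apply le_INR in hm. replace (INR 3) with 3 in hm by (simpl; ring).
  set (c := INR m / 2). replace (INR m) with (2 * c) by (unfold c; field).
  assert (hc : 3 / 2 <= c) by (unfold c; lra).
  set (a := 1 / (2 * c)).
  (* The bound [c >= 3 / 2] serves twice: it makes [a < 1 / 2], hence the beta integral converge,
     and [c > 1], hence the boundary terms vanish at infinity. *)
  assert (ha : 0 < a) by (apply Rdiv_lt_0_compat; lra).
  assert (ha2 : a < 1 / 2).
  { apply Rmult_lt_reg_r with (2 * c); [lra|]. unfold a. field_simplify; lra. }
  destruct (ex_beta_int (1 + a) (3 / 2) ltac:(lra) ltac:(lra)) as [l hl].
  replace (PI / (2 * c)) with (PI * a) by (unfold a; field; lra).
  rewrite <- (beta_int_value a l ha ha2 hl).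
  assert (h1 : is_RInt_pos (fun t => sqrt (1 + Rpower t (2 * c)) - Rpower t c
     - c ^ 2 / (c + 1) * (Rpower t (2 * c) * Rpower (1 + Rpower t (2 * c)) (- (3 / 2)))) (0 - 0)).
  { apply is_RInt_pos_derive with (parts_boundary c).
    - intros t ht. apply is_derive_parts_boundary; lra.
    - intros t ht. apply (ex_derive_continuous (V := R_NormedModule)).
      unfold Rpower. auto_derive. assert (h := exp_pos (2 * c * ln t)). repeat split; lra.
    - apply parts_boundary_0; lra.
    - apply parts_boundary_p; lra. }
  assert (h2 := beta_int_power_subst c l ltac:(lra) hl).
  apply (is_RInt_gen_scal _ (c ^ 2 / (c + 1))) in h2.
  apply (is_RInt_gen_plus _ _ _ _ h1) in h2.
  (* With [a = 1 / (2 c)], both constants are [c / (2 (c + 1))]. *)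
  replace (l / (4 * (1 / 2 + a)))
    with (plus (0 - 0) (scal (c ^ 2 / (c + 1)) (l / (2 * c)))).
  2:{ unfold plus, scal; simpl; unfold mult; simpl. unfold a. field. lra. }
  apply is_RInt_pos_ext with (2 := h2).
  intros t ht. unfold plus, scal; simpl; unfold mult; simpl. ring.
Qed.
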